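(* Let $\mathscr{L}$ be a propositional language (with at least one atom $q$) extended by modal operators $K$ and $\square$. Let $S$ be the following system in $\mathscr{L}$ ($\phi,\psi$ range over all formulas of $\mathscr{L}$): (1) (Global) $\square(\phi\rightarrow\psi)\rightarrow(\square(\phi)\rightarrow\square(\psi))$; (2) (Global) $(K(\phi\rightarrow\psi)\wedge K(\phi))\rightarrow K(\psi)$; (3) (Local) $K(\phi)\rightarrow\phi$; (4) (Global) the strong knowability thesis: $\diamond(K(\phi))$; (5) the rule of global necessitation for $\square$; (6) the rule of global necessitation for $K$. Then $S\not\models q\rightarrow K(q)$.
   Context: $\diamond$ abbreviates $\neg\square\neg$. Semantics: a model assigns arbitrary truth values to the atoms and to the formulas of the forms $K(\phi)$ and $\square(\phi)$; connectives are interpreted classically. A formula is logically valid if it is true in every model (i.e., it is a classical tautology with formulas $K(\phi)$, $\square(\phi)$ treated as additional atoms). Systems and derivability: for a system $S$ consisting of a set of global axioms, a set of local axioms, and the rules of global necessitation for $K$ and $\square$ (with modus ponens implicitly included), $S\models\phi$ means that there is a finite sequence $\phi_1,\ldots,\phi_m$ with $\phi_m=\phi$ such that for each $i$ one of the following holds: (i) $\phi_i$ is a local axiom; (ii) $\phi_i$ is a global axiom; (iii) $\phi_i$ is logically valid; (iv) $\phi_i$ follows from two earlier members of the sequence by modus ponens; (v) $\phi_i$ is $K(\phi_j)$ or $\square(\phi_j)$ for some $j<i$ such that for every $1\le k\le j$, $\phi_k$ is an instance of one of items (ii)-(v) of this list (so local axioms are not used up to step $j$). *)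

(* Defs.v *)
From mathcomp Require Import all_boot.

Set Implicit Arguments.
Unset Strict Implicit.
Unset Printing Implicit Defensive.

(* Formulas over an arbitrary type of atoms. All the usual connectives are
   primitive; only the diamond is an abbreviation. *)
Inductive formula (A : Type) : Type :=
| Atom of A
| Neg of formula A
| And of formula A & formula A
| Or of formula A & formula A
| Imp of formula A & formula A
| Iff of formula A & formula A
| K of formula A
| Box of formula A.

Declare Scope formula_scope.
Delimit Scope formula_scope with F.
Bind Scope formula_scope with formula.

Notation "¬ p" := (Neg p) (at level 35, right associativity) : formula_scope.
Notation "p ∧ q" := (And p q) (at level 80, right associativity) : formula_scope.
Notation "p ∨ q" := (Or p q) (at level 85, right associativity) : formula_scope.
Notation "p → q" := (Imp p q) (at level 99, q at level 200, right associativity)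
  : formula_scope.
Notation "p ↔ q" := (Iff p q) (at level 95, no associativity) : formula_scope.
Notation "□ p" := (Box p) (at level 35, right associativity) : formula_scope.
Notation "◇ p" := (Neg (Box (Neg p))) (at level 35, right associativity)
  : formula_scope.

(* The truth values of [K p] and [Box p] are as arbitrary as those of atoms:
   they need not depend on the truth value of [p]. *)
Record model (A : Type) := Model {
  atom_val : A -> bool;
  K_val : formula A -> bool;
  Box_val : formula A -> bool
}.

Fixpoint eval (A : Type) (M : model A) (p : formula A) : bool :=
  match p with
  | Atom a => atom_val M a
  | Neg p1 => ~~ eval M p1
  | And p1 p2 => eval M p1 && eval M p2
  | Or p1 p2 => eval M p1 || eval M p2
  | Imp p1 p2 => eval M p1 ==> eval M p2
  | Iff p1 p2 => eval M p1 == eval M p2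
  | K p1 => K_val M p1
  | Box p1 => Box_val M p1
  end.

Definition logically_valid (A : Type) (p : formula A) : Prop :=
  forall M : model A, eval M p.

(* Modus ponens and the rules of global necessitation for [K] and [Box] belong
   to every system, so only the axioms are recorded. *)
Record system (A : Type) := System {
  global_axiom : formula A -> Prop;
  local_axiom : formula A -> Prop
}.

(* [nonlocal_step S s i]: the [i]-th member of the sequence [s] (counted from 0)
   has a justification other than being a local axiom. Necessitation may be
   applied to the [j]-th member only if this holds of every member up to and
   including the [j]-th. *)
Inductive nonlocal_step (A : Type) (S : system A) (s : seq (formula A)) :
  nat -> Prop :=
| step_global i p :
    onth s i = Some p -> global_axiom S p -> nonlocal_step S s i
| step_valid i p :
    onth s i = Some p -> logically_valid p -> nonlocal_step S s i
| step_mp i j k p q :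
    j < i -> k < i ->
    onth s j = Some (Imp p q) -> onth s k = Some p -> onth s i = Some q ->
    nonlocal_step S s i
| step_nec_K i j p :
    j < i -> (forall k, k <= j -> nonlocal_step S s k) ->
    onth s j = Some p -> onth s i = Some (K p) -> nonlocal_step S s i
| step_nec_Box i j p :
    j < i -> (forall k, k <= j -> nonlocal_step S s k) ->
    onth s j = Some p -> onth s i = Some (Box p) -> nonlocal_step S s i.

Definition derivation (A : Type) (S : system A) (s : seq (formula A)) : Prop :=
  forall i p, onth s i = Some p -> local_axiom S p \/ nonlocal_step S s i.

Definition derives (A : Type) (S : system A) (p : formula A) : Prop :=
  exists s : seq (formula A), derivation S (rcons s p).

Inductive knowability_global (A : Type) : formula A -> Prop :=
| Box_distr p q : knowability_global (□ (p → q) → (□ p → □ q))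
| K_distr p q : knowability_global ((K (p → q) ∧ K p) → K q)
| strong_knowability p : knowability_global (◇ K p).

Inductive knowability_local (A : Type) : formula A -> Prop :=
| K_factive p : knowability_local (K p → p).

Definition knowability_system (A : Type) : system A :=
  System (@knowability_global A) (@knowability_local A).

(* Main.v *)
Require Import Defs.
From mathcomp Require Import all_boot.

Set Implicit Arguments.
Unset Strict Implicit.
Unset Printing Implicit Defensive.

(** The independence is witnessed by a Kripke model with two worlds. At the
    actual world every atom is true, and [K] sees both worlds; at the blind
    world every atom is false, and [K] sees no world at all. From either world,
    [Box] sees exactly the blind world.

    At the blind world [K p] holds vacuously for every [p], a contradiction
    included, so strong knowability holds at both worlds; the distribution
    axioms hold because the model is a Kripke model. Truth at both worlds is
    preserved by modus ponens and by both rules of necessitation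
    ([nonlocal_prefix_sound]). Factivity of [K] fails at the blind world, but it
    holds at the actual one, which sees itself, and a local axiom has to hold
    only there: necessitation never applies to its consequences. Hence every
    derivable formula is true at the actual world ([derives_actual]). But there
    [q] is true and [K q] is false, since [q] fails at the blind world. *)

Variant world := Actual | Blind.

Fixpoint holds (A : Type) (w : world) (p : formula A) : bool :=
  match p with
  | Atom _ => if w is Actual then true else false
  | Neg p1 => ~~ holds w p1
  | And p1 p2 => holds w p1 && holds w p2
  | Or p1 p2 => holds w p1 || holds w p2
  | Imp p1 p2 => holds w p1 ==> holds w p2
  | Iff p1 p2 => holds w p1 == holds w p2
  | K p1 => if w is Actual then holds Actual p1 && holds Blind p1 else true
  | Box p1 => holds Blind p1
  end.

(** Each world, taken on its own, is one of the models that define logical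
    validity: it merely fixes the values of the modal formulas. *)
Lemma logically_valid_holds (A : Type) (p : formula A) (w : world) :
  logically_valid p -> holds w p.
Proof.
pose M := Model (fun a : A => holds w (Atom a)) (fun r => holds w (K r))
                (fun r => holds w (Box r)).
have evalE r : eval M r = holds w r.
  by elim: r => //= [r -> | r -> t -> | r -> t -> | r -> t -> | r -> t ->].
by move=> /(_ M); rewrite evalE.
Qed.

Lemma global_axiom_holds (A : Type) (p : formula A) (w : world) :
  knowability_global p -> holds w p.
Proof.
case=> [r t | r t | r] /=; first by apply/implyP.
  by case: w => //; do 4 case: holds.
by [].
Qed.

Lemma local_axiom_holds_actual (A : Type) (p : formula A) :
  knowability_local p -> holds Actual p.
Proof. by case=> r /=; apply/implyP=> /andP[]. Qed.

(** Strong induction on the position, not induction on the justification: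
    modus ponens does not record that its premises are free of local axioms, so
    this has to come from the hypothesis on the whole prefix. *)
Lemma nonlocal_prefix_sound (A : Type) (s : seq (formula A)) (j : nat) :
  (forall k, k <= j -> nonlocal_step (knowability_system A) s k) ->
  forall (p : formula A) (w : world), onth s j = Some p -> holds w p.
Proof.
elim/ltn_ind: j => j IH prefix.
have earlier k r w : k < j -> onth s k = Some r -> holds w r.
  move=> lt_kj; apply: (IH k lt_kj) => l le_lk.
  by apply: prefix; apply: leq_trans le_lk (ltnW lt_kj).
move=> p w s_j; have step := prefix j (leqnn j).
case: step s_j earlier => {j IH prefix}
    [i r s_i ax | i r s_i val | i j k r t ji ki s_j s_k s_i
    | i j r ji _ s_j s_i | i j r ji _ s_j s_i];
  rewrite s_i => -[<-] earlier.
- exact: global_axiom_holds.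
- exact: logically_valid_holds.
- by have /implyP := earlier _ _ w ji s_j; apply; apply: earlier ki s_k.
- by case: w => //=; rewrite !(earlier _ _ _ ji s_j).
- exact: earlier ji s_j.
Qed.

Lemma derives_actual (A : Type) (p : formula A) :
  derives (knowability_system A) p -> holds Actual p.
Proof.
move=> [s0]; set s := rcons s0 p => der.
suff sound i r : onth s i = Some r -> holds Actual r.
  by apply: (sound (size s0)); rewrite /s -cats1 onth_cat ltnn subnn.
elim/ltn_ind: i r => i IH r s_i.
case: (der i r s_i) => [|step]; first exact: local_axiom_holds_actual.
case: step s_i IH => {i}
    [i t s_i ax | i t s_i val | i j k t u ji ki s_j s_k s_i
    | i j t ji prefix s_j s_i | i j t ji prefix s_j s_i];
  rewrite s_i => -[<-] IH.
- exact: global_axiom_holds.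
- exact: logically_valid_holds.
- by have /implyP := IH _ ji _ s_j; apply; apply: IH ki _ s_k.
- by rewrite /= !(nonlocal_prefix_sound prefix _ s_j).
- exact: (nonlocal_prefix_sound prefix Blind s_j).
Qed.

Theorem theorem4p1 (A : Type) (q : A) :
  ~ derives (knowability_system A) (Atom q → K (Atom q))%F.
Proof. by move/derives_actual. Qed.
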